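(* Let $M$ be a connected manifold endowed with a conic pseudo-Finsler metric $F:A\to[0,\infty)$, $A\subset TM$. Then, for all $p\in M$ and $r>0$, the open forward and backward $d_F$-balls $$B^+_F(p,r)=\{q\in M: d_F(p,q)<r\},\qquad B^-_F(p,r)=\{q\in M: d_F(q,p)<r\}$$ are open subsets of $M$.
   Context: Let $\pi:TM\to M$ be the natural projection. A conic pseudo-Finsler metric on $M$ is a pair $(A,F)$ where $A\subset TM$ is open with $\pi(A)=M$ and conic ($v\in A$, $\lambda>0$ imply $\lambda v\in A$), and $F:A\to[0,\infty)$ is continuous, smooth on $A$ except at most at the zero vectors, with $F(v)=0$ iff $v$ is a zero vector and $F(\lambda v)=\lambda F(v)$ for $\lambda>0$, $v\in A$. (The zero vector of $T_pM$ may belong to $A$ only if $T_pM\subset A$.) A piecewise smooth curve $\alpha:[a,b]\to M$ is ($F$-)admissible if its right and left derivatives $\dot\alpha_\pm(t)$ (those which make sense) belong to $A$ for every $t\in[a,b]$. Its length is $\ell_F(\alpha)=\int_a^bF(\dot\alpha(t))\,dt$. The Finslerian separation from $p$ to $q$ is $d_F(p,q)=\inf\ell_F(\alpha)\in[0,\infty]$, the infimum being taken over all admissible piecewise smooth curves from $p$ to $q$ (so $d_F(p,q)=\infty$ if there are none, and possibly $d_F(p,p)=\infty$). *)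

(* Defs.v *)
From HB Require Import structures.
From mathcomp Require Import all_boot all_order all_algebra.
From mathcomp Require Import all_classical all_reals all_analysis.
Import Order.TTheory GRing.Theory Num.Theory.
Import numFieldNormedType.Exports.

Set Implicit Arguments.
Unset Strict Implicit.
Unset Printing Implicit Defensive.

Local Open Scope classical_set_scope.
Local Open Scope ring_scope.

(* Meant for finite-dimensional V and open D: there, asking that every
   directional derivative be C^k is the same as asking it of the Frechet
   derivative.  Only the values of f on D matter. *)
Fixpoint Ck_on (R : realType) (V W : normedModType R) (k : nat)
    (D : set V) (f : V -> W) : Prop :=
  match k with
  | 0%N => forall x, D x -> {for x, continuous f}
  | k'.+1 => (forall x, D x -> differentiable f x) /\
             (forall v, Ck_on k' D (fun x => 'D_v f x))
  end.

Definition smooth_on (R : realType) (V W : normedModType R)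
    (D : set V) (f : V -> W) : Prop :=
  forall k, Ck_on k D f.

(* The values of chart_map off chart_dom, and of chart_inv off the image of
   chart_dom, are irrelevant. *)
Record chart (R : realType) (n : nat) (M : topologicalType) := Chart {
  chart_dom : set M ;
  chart_map :> M -> 'rV[R]_n ;
  chart_inv : 'rV[R]_n -> M ;
  chart_dom_open : open chart_dom ;
  chart_img_open : open (chart_map @` chart_dom) ;
  chart_mapK : forall x, chart_dom x -> chart_inv (chart_map x) = x ;
  chart_map_continuous : forall x, chart_dom x ->
    {for x, continuous chart_map} ;
  chart_inv_continuous : forall x, chart_dom x ->
    {for chart_map x, continuous chart_inv}
}.

Definition transition (R : realType) (n : nat) (M : topologicalType)
    (phi psi : chart R n M) : 'rV[R]_n -> 'rV[R]_n :=
  fun x => psi (chart_inv phi x).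

(* The atlas is not required to be maximal. *)
Record smoothManifold (R : realType) (n : nat) := SmoothManifold {
  carrier :> topologicalType ;
  atlas : set (chart R n carrier) ;
  atlas_cover : forall p, exists2 phi, atlas phi & chart_dom phi p ;
  atlas_smooth : forall phi psi, atlas phi -> atlas psi ->
    smooth_on (phi @` (chart_dom phi `&` chart_dom psi)) (transition phi psi) ;
  manifold_hausdorff : hausdorff_space carrier ;
  manifold_second_countable : @second_countable carrier
}.

Definition chart_at (R : realType) (n : nat) (M : smoothManifold R n)
    (p : M) (phi : chart R n M) : Prop :=
  atlas phi /\ chart_dom phi p.

(* A tangent vector at p is a family of vectors of R^n indexed by the charts at
   p and transforming by the differentials of the transition maps.  The
   components at the other charts are set to 0, so that two tangent vectors
   with the same base point and components are equal. *)
Record tangentBundle (R : realType) (n : nat) (M : smoothManifold R n) :=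
  TangentVector {
  tbase : M ;
  tcomp : chart R n M -> 'rV[R]_n ;
  tcomp_transition : forall phi psi,
    chart_at tbase phi -> chart_at tbase psi ->
    tcomp psi = 'D_(tcomp phi) (transition phi psi) (phi tbase) ;
  tcomp_out : forall phi, ~ chart_at tbase phi -> tcomp phi = 0
}.

Definition tchart (R : realType) (n : nat) (M : smoothManifold R n)
    (phi : chart R n M) (v : tangentBundle M) : 'rV[R]_n * 'rV[R]_n :=
  (phi (tbase v), tcomp v phi).

Definition tdom (R : realType) (n : nat) (M : smoothManifold R n)
    (phi : chart R n M) : set (tangentBundle M) :=
  [set v | chart_dom phi (tbase v)].

(* The manifold topology of TM: tchart phi is a bijection from tdom phi onto the
   open set phi (dom phi) x R^n, and U is open iff all the images
   tchart phi (U `&` tdom phi) are. *)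
Definition topen (R : realType) (n : nat) (M : smoothManifold R n)
    (U : set (tangentBundle M)) : Prop :=
  forall phi, atlas phi ->
    exists2 O : set ('rV[R]_n * 'rV[R]_n), open O &
      U `&` tdom phi = tchart phi @^-1` O `&` tdom phi.

Fact topenT (R : realType) (n : nat) (M : smoothManifold R n) :
  topen [set: tangentBundle M].
Proof. by move=> phi _; exists setT; [exact: openT|rewrite preimage_setT]. Qed.

Fact topenI (R : realType) (n : nat) (M : smoothManifold R n) :
  setI_closed (@topen R n M).
Proof.
move=> U V Uo Vo phi aphi.
have [N oN UE] := Uo phi aphi.
have [P oP VE] := Vo phi aphi.
exists (N `&` P); first exact: openI.
by rewrite preimage_setI setIIl UE VE -setIIl.
Qed.

Fact topen_bigU (R : realType) (n : nat) (M : smoothManifold R n)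
    (I : Type) (U : I -> set (tangentBundle M)) :
  (forall i, topen (U i)) -> topen (\bigcup_i U i).
Proof.
move=> Uo phi aphi.
have /choice[N NP] : forall i, exists N : set ('rV[R]_n * 'rV[R]_n),
    open N /\ U i `&` tdom phi = tchart phi @^-1` N `&` tdom phi.
  by move=> i; have [N oN UE] := Uo i phi aphi; exists N.
exists (\bigcup_i N i); first by apply: bigcup_open => i _; have [] := NP i.
rewrite preimage_bigcup !setI_bigcupl.
by apply: eq_bigcupr => i _; have [] := NP i.
Qed.

HB.instance Definition _ (R : realType) (n : nat) (M : smoothManifold R n) :=
  gen_eqMixin (tangentBundle M).
HB.instance Definition _ (R : realType) (n : nat) (M : smoothManifold R n) :=
  gen_choiceMixin (tangentBundle M).
HB.instance Definition _ (R : realType) (n : nat) (M : smoothManifold R n) :=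
  isOpenTopological.Build (tangentBundle M)
    (@topenT R n M) (@topenI R n M) (@topen_bigU R n M).

Fact tscale_transition (R : realType) (n : nat) (M : smoothManifold R n)
    (c : R) (v : tangentBundle M) (phi psi : chart R n M) :
  chart_at (tbase v) phi -> chart_at (tbase v) psi ->
  c *: tcomp v psi =
    'D_(c *: tcomp v phi) (transition phi psi) (phi (tbase v)).
Proof.
move=> vphi vpsi; rewrite (tcomp_transition vphi vpsi).
case: vphi vpsi => aphi dphi [apsi dpsi].
have [df _] := atlas_smooth aphi apsi 1%N.
have {}df : differentiable (transition phi psi) (phi (tbase v)).
  by apply: df; exists (tbase v).
by rewrite !deriveE// linearZ.
Qed.

Fact tscale_out (R : realType) (n : nat) (M : smoothManifold R n)
    (c : R) (v : tangentBundle M) (phi : chart R n M) :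
  ~ chart_at (tbase v) phi -> c *: tcomp v phi = 0.
Proof. by move=> /tcomp_out ->; rewrite scaler0. Qed.

Definition tscale (R : realType) (n : nat) (M : smoothManifold R n)
    (c : R) (v : tangentBundle M) : tangentBundle M :=
  TangentVector (@tscale_transition R n M c v) (@tscale_out R n M c v).

Definition tzero (R : realType) (n : nat) (M : smoothManifold R n) :
    set (tangentBundle M) :=
  [set v | forall phi, tcomp v phi = 0].

(* F is a total function, but only its values on A matter.  A zero vector of
   T_pM can belong to A only if T_pM `<=` A: this follows from A being open and
   conic, hence is not a separate field. *)
Record conicPseudoFinsler (R : realType) (n : nat) (M : smoothManifold R n)
    (A : set (tangentBundle M)) (F : tangentBundle M -> R) : Prop := {
  cpf_open : open A ;
  cpf_onto : @tbase R n M @` A = [set: M] ;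
  cpf_conic : forall v (c : R), A v -> 0 < c -> A (tscale c v) ;
  cpf_ge0 : forall v, A v -> 0 <= F v ;
  cpf_continuous : forall v, A v -> {for v, continuous F} ;
  cpf_smooth : forall phi, atlas phi ->
    exists2 G : 'rV[R]_n * 'rV[R]_n -> R^o,
      smooth_on (tchart phi @` ((A `\` @tzero R n M) `&` tdom phi)) G &
      forall v, ((A `\` @tzero R n M) `&` tdom phi) v -> F v = G (tchart phi v) ;
  cpf_eq0 : forall v, A v -> (F v = 0 <-> tzero v) ;
  cpf_homogeneous : forall v (c : R), A v -> 0 < c -> F (tscale c v) = c * F v
}.

Definition smooth_curve_on (R : realType) (n : nat) (M : smoothManifold R n)
    (J : set R) (g : R -> M) : Prop :=
  (forall t, J t -> {for t, continuous g}) /\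
  (forall phi, atlas phi ->
     smooth_on (V := R^o) (J `&` g @^-1` chart_dom phi) (phi \o g)).

(* Smooth up to the endpoints, i.e. extendable to a smooth curve on an open
   neighbourhood of [s, t]. *)
Definition smooth_on_segment (R : realType) (n : nat) (M : smoothManifold R n)
    (s t : R) (alpha : R -> M) : Prop :=
  exists (J : set R) (g : R -> M),
    [/\ open J, `[s, t] `<=` J, smooth_curve_on J g &
        forall u, u \in `[s, t] -> g u = alpha u].

(* Curves are total functions of which only the restriction to [a, b] matters *)
Definition piecewise_smooth (R : realType) (n : nat) (M : smoothManifold R n)
    (a b : R) (alpha : R -> M) : Prop :=
  exists2 s : seq R, itv_partition a b s &
    forall i, (i < size s)%N ->
      smooth_on_segment (nth b (a :: s) i) (nth b (a :: s) i.+1) alpha.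

(* v is the derivative of alpha at t along increments h tending to 0 in the
   sense of G: right, left and two-sided derivatives are obtained for
   G = 0^'+, 0^'- and 0^'. *)
Definition is_velocity (R : realType) (n : nat) (M : smoothManifold R n)
    (G : set_system R) (alpha : R -> M) (t : R) (v : tangentBundle M) : Prop :=
  tbase v = alpha t /\
  forall phi, chart_at (alpha t) phi ->
    h^-1 *: (phi (alpha (t + h)) - phi (alpha t)) @[h --> G] --> tcomp v phi.

(* The interval is nondegenerate: d_F(p, p) may be +oo. *)
Record admissible_curve (R : realType) (n : nat) (M : smoothManifold R n)
    (A : set (tangentBundle M)) (p q : M) (a b : R) (alpha : R -> M) : Prop := {
  adm_lt : a < b ;
  adm_smooth : piecewise_smooth a b alpha ;
  adm_start : alpha a = p ;
  adm_end : alpha b = q ;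
  adm_right : forall t, a <= t < b ->
    exists2 v, A v & is_velocity 0^'+ alpha t v ;
  adm_left : forall t, a < t <= b ->
    exists2 v, A v & is_velocity 0^'- alpha t v
}.

(* F (alpha'(t)); the value 0 is used where alpha'(t) does not exist, which for
   a piecewise smooth curve on [a, b] concerns finitely many t. *)
Definition speed (R : realType) (n : nat) (M : smoothManifold R n)
    (F : tangentBundle M -> R) (alpha : R -> M) (t : R) : R :=
  xget 0 (F @` [set v | is_velocity 0^' alpha t v]).

Definition curve_length (R : realType) (n : nat) (M : smoothManifold R n)
    (F : tangentBundle M -> R) (a b : R) (alpha : R -> M) : \bar R :=
  (\int[lebesgue_measure]_(t in `[a, b]) (speed F alpha t)%:E)%E.

Definition finsler_separation (R : realType) (n : nat) (M : smoothManifold R n)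
    (A : set (tangentBundle M)) (F : tangentBundle M -> R) (p q : M) : \bar R :=
  ereal_inf [set l | exists (a b : R) (alpha : R -> M),
    admissible_curve A p q a b alpha /\ l = curve_length F a b alpha].

Definition forward_ball (R : realType) (n : nat) (M : smoothManifold R n)
    (A : set (tangentBundle M)) (F : tangentBundle M -> R) (p : M) (r : R) :
    set M :=
  [set q | (finsler_separation A F p q < r%:E)%E].

Definition backward_ball (R : realType) (n : nat) (M : smoothManifold R n)
    (A : set (tangentBundle M)) (F : tangentBundle M -> R) (p : M) (r : R) :
    set M :=
  [set q | (finsler_separation A F q p < r%:E)%E].

(* Main.v *)
(** Let [alpha] be an admissible curve from [p] to [q] of length less than [r],
    with final velocity [v] in [A].  In a chart around [q] the difference
    quotients of [alpha] at its final time [b] tend to [v], so for [c < b] close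
    to [b] the chart segment parametrized by [[c, b]] from [alpha c] to any [q']
    close enough to [q] has velocity close to [v]: it is admissible because [A]
    is open, and by continuity [F <= F v + 1] along it, so that its length is at
    most [(F v + 1) (b - c)].  Replacing the end of [alpha] by this segment
    reaches all the points near [q] with length less than [r].  Backward balls
    are dealt with in the same way at the initial time. *)

Require Import Defs.
From HB Require Import structures.
From mathcomp Require Import all_boot all_order all_algebra.
From mathcomp Require Import all_classical all_reals all_analysis.
From mathcomp Require Import measurable_realfun lra.
Import Order.TTheory GRing.Theory Num.Theory.
Import numFieldNormedType.Exports.

Set Implicit Arguments.
Unset Strict Implicit.
Unset Printing Implicit Defensive.

Local Open Scope classical_set_scope.
Local Open Scope ring_scope.

(** * Integrals of nonnegative functions bounded through simple functions *)

Import HBNNSimple.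

(* No measurability is assumed: the integral of a nonnegative function is a
   supremum over the simple functions below it.  This avoids proving that the
   speed of a curve is measurable. *)
Lemma ge0_le_integral_restrict d (T : measurableType d) (R : realType)
    (mu : {measure set T -> \bar R}) (D E : set T) (f g : T -> \bar R) :
  (forall x, D x -> 0 <= f x)%E -> (forall x, E x -> 0 <= g x)%E ->
  (forall x, (f \_ D) x <= (g \_ E) x)%E ->
  (\int[mu]_(x in D) f x <= \int[mu]_(x in E) g x)%E.
Proof.
move=> f0 g0 fg; rewrite !ge0_integralE//.
apply: ge_ereal_sup => _ [h /= hf <-]; apply: ereal_sup_ubound.
by exists h => // x; apply: le_trans (fg x).
Qed.

(** A simple function below [f] on [D] is measurable, so its integral splits exactly along [E] and
    its complement, and each of its two pieces lies below the corresponding restriction of [f]. *)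
Lemma ge0_integral_split_le d (T : measurableType d) (R : realType)
    (mu : {measure set T -> \bar R}) (D E : set T) (f : T -> \bar R) :
  measurable E -> (forall x, D x -> 0 <= f x)%E ->
  (\int[mu]_(x in D) f x <=
    \int[mu]_(x in D `&` E) f x + \int[mu]_(x in D `\` E) f x)%E.
Proof.
move=> mE f0; rewrite [X in (X <= _)%E]ge0_integralE//.
apply: ge_ereal_sup => _ [h /= hf <-].
have mh : measurable_fun (E `|` ~` E) (EFin \o h).
  exact/measurable_EFinP/measurable_funTS.
rewrite -integralT_nnsfun -(setUv E) ge0_integral_setU//; last 3 first.
- exact: measurableC.
- by move=> x _; rewrite lee_fin; exact: fun_ge0.
- by apply/disj_setPS => x [].
apply: leeD; apply: ge0_le_integral_restrict => [x _|x [/f0//]|x].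
- by rewrite lee_fin; exact: fun_ge0.
- have := hf x; rewrite /patch in_setI andbC.
  by case: (x \in E); case: (x \in D).
- by rewrite lee_fin; exact: fun_ge0.
- have := hf x; rewrite /patch in_setD in_setC andbC.
  by case: (x \in E); case: (x \in D).
Qed.

(** Meant for the speed of a concatenated curve, which is controlled on either side of the junction
    [c] but not at [c] itself; this point is a null set. *)
Lemma ge0_integral_itv_cat_le (R : realType) (a c b : R)
    (f g1 g2 : R -> \bar R) :
  (forall x, x \in `[a, b] -> 0 <= f x)%E ->
  (forall x, x \in `[a, c] -> 0 <= g1 x)%E ->
  (forall x, x \in `[c, b] -> 0 <= g2 x)%E ->
  (forall x, x \in `[a, c[ -> f x <= g1 x)%E ->
  (forall x, x \in `]c, b] -> f x <= g2 x)%E ->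
  (\int[lebesgue_measure]_(x in `[a, b]) f x <=
    \int[lebesgue_measure]_(x in `[a, c]) g1 x +
    \int[lebesgue_measure]_(x in `[c, b]) g2 x)%E.
Proof.
move=> f0 g10 g20 fg1 fg2.
have mE : measurable [set` `]-oo, c[%R] by [].
apply: (le_trans (ge0_integral_split_le lebesgue_measure mE f0)).
apply: leeD.
  apply: ge0_le_integral_restrict => // [x [/f0]//|x].
  rewrite /patch; case: ifPn; rewrite ?in_setE /= ?in_itv/=.
    move=> [] /andP[ax xb] xc; rewrite ifT.
      by apply: fg1; rewrite in_itv/= ax.
    by rewrite inE/= in_itv/= ax ltW.
  by move=> _; case: ifPn => // /set_mem /g10.
(* What remains is the half of the interval from [c] on; [c] is split off and contributes 0. *)
have mc : measurable [set c] by [].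
apply: (le_trans (ge0_integral_split_le lebesgue_measure mc _)).
  by move=> x [/f0].
rewrite (@integral_Sset1 _ f _ c) ?add0e; last by move=> x [].
apply: ge0_le_integral_restrict => // [x [[/f0]]//|x].
rewrite /patch; case: ifPn; rewrite ?in_setE /= ?in_itv/=.
  move=> [[] /andP[ax xb]] /negP; rewrite -leNgt => cx /eqP xc.
  rewrite ifT; last by rewrite inE/= in_itv/= cx.
  by apply: fg2; rewrite in_itv/= lt_neqAle cx xb eq_sym xc.
by move=> _; case: ifPn => // /set_mem /g20.
Qed.

(** * Tangent vectors and segments in charts *)

Lemma tangent_eq (R : realType) (n : nat) (M : smoothManifold R n)
    (v w : tangentBundle M) :
  tbase v = tbase w -> tcomp v = tcomp w -> v = w.
Proof.
case: v w => [p c cT c0] [q e eT e0] /= pq ce; subst q e.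
by congr TangentVector; exact: Prop_irrelevance.
Qed.

(** In a chart at [alpha t] this is uniqueness of limits; at every other chart both components are 0
    by [tcomp_out]. *)
Lemma is_velocity_unique (R : realType) (n : nat) (M : smoothManifold R n)
    (G : set_system R) {PG : ProperFilter G} (alpha : R -> M) (t : R)
    (v w : tangentBundle M) :
  is_velocity G alpha t v -> is_velocity G alpha t w -> v = w.
Proof.
move=> [bv cv] [bw cw]; apply: tangent_eq; first by rewrite bv.
apply/funext => phi; have [atphi|natphi] := pselect (chart_at (alpha t) phi).
  exact: (cvg_unique (@norm_hausdorff _ _) (cv _ atphi) (cw _ atphi)).
by rewrite !tcomp_out ?bv ?bw.
Qed.

(** The filters used for [G] live on nonzero increments, hence the separate hypothesis at [t]
    itself. *)
Lemma is_velocity_near (R : realType) (n : nat) (M : smoothManifold R n)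
    (G : set_system R) {FG : Filter G} (alpha beta : R -> M) (t : R)
    (v : tangentBundle M) :
  alpha t = beta t -> (\forall h \near G, alpha (t + h) = beta (t + h)) ->
  is_velocity G alpha t v -> is_velocity G beta t v.
Proof.
move=> abt ab [bv cv]; split; first by rewrite -abt.
move=> phi; rewrite -abt => /cv; apply: cvg_trans; apply: near_eq_cvg.
by near=> h; rewrite (near ab h).
Unshelve. all: by end_near. Qed.

Lemma is_velocity_cvg (R : realType) (n : nat) (M : smoothManifold R n)
    (G H : set_system R) (alpha : R -> M) (t : R) (v : tangentBundle M) :
  H --> G -> is_velocity G alpha t v -> is_velocity H alpha t v.
Proof.
by move=> HG [bv cv]; split => // phi /cv; apply: cvg_trans; exact: cvg_app.
Qed.

Lemma chart_inv_near (R : realType) (n : nat) (M : topologicalType)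
    (phi : chart R n M) (p : M) (U : set M) :
  chart_dom phi p -> nbhs p U -> \forall x \near phi p, U (chart_inv phi x).
Proof.
by move=> dp pU; apply: (chart_inv_continuous dp); rewrite chart_mapK.
Qed.

Lemma chart_img_near (R : realType) (n : nat) (M : topologicalType)
    (phi : chart R n M) (p : M) :
  chart_dom phi p -> \forall x \near phi p,
    chart_dom phi (chart_inv phi x) /\ phi (chart_inv phi x) = x.
Proof.
move=> dp; have : nbhs (phi p) (phi @` chart_dom phi).
  by apply: open_nbhs_nbhs; split; [exact: chart_img_open|exists p].
by apply: filterS => _ [q dq <-]; rewrite chart_mapK.
Qed.

Lemma transitionE (R : realType) (n : nat) (M : smoothManifold R n)
    (phi psi : chart R n M) (p : M) :
  chart_dom phi p -> transition phi psi (phi p) = psi p.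
Proof. by move=> dp; rewrite /transition chart_mapK. Qed.

Lemma differentiable_transition (R : realType) (n : nat)
    (M : smoothManifold R n) (phi psi : chart R n M) (p : M) :
  chart_at p phi -> chart_at p psi ->
  differentiable (transition phi psi) (phi p).
Proof.
move=> [aphi dphi] [apsi dpsi]; have [df _] := atlas_smooth aphi apsi 1%N.
by apply: df; exists p.
Qed.

Lemma derive_transition_id (R : realType) (n : nat) (M : smoothManifold R n)
    (phi : chart R n M) (p : M) (w : 'rV[R]_n) :
  chart_dom phi p -> 'D_w (transition phi phi) (phi p) = w.
Proof.
move=> dp; rewrite (@near_eq_derive _ _ _ _ id) ?derive_id//.
by near=> x; rewrite /transition; have [] := near (chart_img_near dp) x.
Unshelve. all: by end_near. Qed.

(** The chain rule: near [phi p] the transition from [phi] to [chi] factors through [psi], since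
    [chart_inv phi] stays in [chart_dom psi] there. *)
Lemma derive_transition_comp (R : realType) (n : nat) (M : smoothManifold R n)
    (phi psi chi : chart R n M) (p : M) (w : 'rV[R]_n) :
  chart_at p phi -> chart_at p psi -> chart_at p chi ->
  'D_w (transition phi chi) (phi p) =
    'D_('D_w (transition phi psi) (phi p)) (transition psi chi) (psi p).
Proof.
move=> pphi ppsi pchi.
have dpp := differentiable_transition pphi ppsi.
have dpc := differentiable_transition ppsi pchi.
case: (pphi) (ppsi) => _ dphi [_ dpsi].
rewrite (@near_eq_derive _ _ _ _ (transition psi chi \o transition phi psi)).
  rewrite [in LHS]deriveE; last first.
    by apply: differentiable_comp => //; rewrite transitionE.
  by rewrite diff_comp// ?transitionE// !deriveE.
have dpsi' : nbhs p (chart_dom psi).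
  by apply: open_nbhs_nbhs; split; [exact: chart_dom_open|].
near=> x; rewrite /transition /= chart_mapK//.
exact: (near (chart_inv_near dphi dpsi') x).
Unshelve. all: by end_near. Qed.

(** The component [w] in [phi] is propagated to the other charts at [p] by the differentials of the
    transition maps; [derive_transition_comp] is the cocycle identity that makes this family a
    tangent vector. *)
Lemma tangent_vector_exists (R : realType) (n : nat) (M : smoothManifold R n)
    (phi : chart R n M) (p : M) (w : 'rV[R]_n) :
  chart_at p phi -> exists2 v : tangentBundle M, tbase v = p &
    forall psi, chart_at p psi ->
      tcomp v psi = 'D_w (transition phi psi) (phi p).
Proof.
move=> pphi.
pose c psi : 'rV[R]_n := if pselect (chart_at p psi) is left _ then
  'D_w (transition phi psi) (phi p) else 0.
have cE psi : chart_at p psi -> c psi = 'D_w (transition phi psi) (phi p).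
  by rewrite /c; case: pselect.
have cT psi chi : chart_at p psi -> chart_at p chi ->
    c chi = 'D_(c psi) (transition psi chi) (psi p).
  by move=> ppsi pchi; rewrite !cE//; exact: derive_transition_comp.
have c0 psi : ~ chart_at p psi -> c psi = 0.
  by rewrite /c; case: pselect.
by exists (TangentVector cT c0).
Qed.

(** The straight line of the chart that is at [x] at time [t], with velocity [w]. The anchor [t] may
    be either end of the time interval, so that one definition serves both kinds of balls. *)
Definition chart_line (R : realType) (n : nat) (M : smoothManifold R n)
    (phi : chart R n M) (x w : 'rV[R]_n) (t s : R) : M :=
  chart_inv phi (x + (s - t) *: w).

(** Read in a chart [psi], the difference quotients of the line are exactly those of
    [transition phi psi] in the direction [w]. *)
Lemma chart_line_velocity (R : realType) (n : nat) (M : smoothManifold R n)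
    (phi : chart R n M) (x w : 'rV[R]_n) (t s : R) :
  atlas phi -> (phi @` chart_dom phi) (x + (s - t) *: w) ->
  exists v : tangentBundle M, [/\ is_velocity 0^' (chart_line phi x w t) s v,
    tdom phi v & tchart phi v = (x + (s - t) *: w, w)].
Proof.
move=> aphi [p dp xE]; have pE : chart_line phi x w t s = p.
  by rewrite /chart_line -xE chart_mapK.
have [v bv cv] := tangent_vector_exists w (conj aphi dp).
exists v; split.
- split; rewrite pE// => psi ppsi; rewrite cv//.
  have dT := differentiable_transition (conj aphi dp) ppsi.
  have := @diff_derivable _ _ _ _ _ w dT.
  apply: cvg_trans; apply: near_eq_cvg; apply: filterE => h.
  congr (_ *: (_ - _)).
    rewrite /= /transition /chart_line xE addrCA -scalerDl.
    by rewrite (addrC h) addrAC.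
  by rewrite transitionE// pE.
- by rewrite /tdom/= bv.
- by rewrite /tchart bv cv// derive_transition_id// xE.
Qed.

Lemma differentiable_line (R : realType) (V : normedModType R) (x w : V)
    (t : R) (s : R^o) :
  differentiable (fun s : R^o => x + (s - t) *: w) s.
Proof.
apply: differentiableD; first exact: differentiable_cst.
by apply: differentiableZl; exact: differentiableB.
Qed.

(** With a transition map for [f], this gives the smoothness of a chart line read in another
    chart. *)
Lemma Ck_on_line (R : realType) (V W : normedModType R) (k : nat)
    (D : set V) (f : V -> W) (x w : V) (t : R) (E : set R^o) :
  (forall s, E s -> D (x + (s - t) *: w)) ->
  Ck_on k D f -> Ck_on k E (fun s : R^o => f (x + (s - t) *: w)).
Proof.
move=> ED; elim: k f => [f fD s Es|k IH f [df fk]].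
  apply: continuous_comp; last exact/fD/ED.
  exact: differentiable_continuous (differentiable_line _ _ _ _).
split => [s Es|v].
  apply: differentiable_comp; last exact/df/ED.
  exact: differentiable_line.
(* [fun s => x + (s - t) *: w] being affine, the two difference quotients are
   equal, so that no differentiability is needed here. *)
suff -> : 'D_v (fun s : R^o => f (x + (s - t) *: w)) =
    (fun s : R^o => 'D_(v *: w) f (x + (s - t) *: w)).
  exact: (IH _ (fk (v *: w))).
apply/funext => s; rewrite /derive.
apply: (congr1 (fun g : R -> W => lim (g @ 0^'))).
apply/funext => h /=; congr (_ *: (f _ - _)).
by rewrite addrCA scalerA -scalerDl addrA.
Qed.

Lemma chart_line_smooth (R : realType) (n : nat) (M : smoothManifold R n)
    (phi : chart R n M) (x w : 'rV[R]_n) (t : R) :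
  atlas phi -> smooth_curve_on
    [set s : R | (phi @` chart_dom phi) (x + (s - t) *: w)]
    (chart_line phi x w t).
Proof.
move=> aphi; split.
  move=> s /= [p dp xE]; apply: continuous_comp; last first.
    by rewrite -xE; exact: chart_inv_continuous.
  exact: differentiable_continuous (differentiable_line _ _ _ _).
move=> psi apsi k.
apply: (Ck_on_line (f := transition phi psi) _ (atlas_smooth aphi apsi k)).
move=> s /= [[p dp pE]].
by rewrite /chart_line -pE chart_mapK// => dpsi; exists p.
Qed.

(** * Speed and length *)

Lemma near_addr (R : realType) (t : R) (P : set R) :
  nbhs t P -> \forall h \near (0 : R), P (t + h).
Proof.
move=> tP; have : (t + h) @[h --> (0 : R)] --> t + 0.
  by apply: cvgD; [exact: cvg_cst|exact: cvg_id].
by rewrite addr0; apply.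
Qed.

Lemma near_addr_dnbhs (R : realType) (G : set_system R) (t : R) (P : set R) :
  G --> 0^' -> nbhs t P -> \forall h \near G, P (t + h).
Proof. by move=> G0 /near_addr P0; apply: G0; exact: nbhs_dnbhs. Qed.

Lemma at_right0_dnbhs (R : realType) : (0 : R)^'+ --> (0 : R)^'.
Proof.
move=> P P0; have : nbhs (0 : R) [set y | y != 0 -> P y] by [].
by apply: filterS => y Py y0; apply: Py; rewrite gt_eqF.
Qed.

Lemma at_left0_dnbhs (R : realType) : (0 : R)^'- --> (0 : R)^'.
Proof.
move=> P P0; have : nbhs (0 : R) [set y | y != 0 -> P y] by [].
by apply: filterS => y Py y0; apply: Py; rewrite lt_eqF.
Qed.

Lemma speed_near (R : realType) (n : nat) (M : smoothManifold R n)
    (F : tangentBundle M -> R) (alpha beta : R -> M) (t : R) :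
  (\forall s \near t, alpha s = beta s) -> speed F alpha t = speed F beta t.
Proof.
move=> ab; have abt := nbhs_singleton ab.
have abh : \forall h \near 0^', alpha (t + h) = beta (t + h).
  exact: near_addr_dnbhs ab.
have bah : \forall h \near 0^', beta (t + h) = alpha (t + h).
  by apply: filterS abh.
congr (xget 0 (F @` _)); apply/seteqP; split => v /=.
  exact: is_velocity_near.
exact: is_velocity_near.
Qed.

Lemma speedE (R : realType) (n : nat) (M : smoothManifold R n)
    (F : tangentBundle M -> R) (alpha : R -> M) (t : R) (v : tangentBundle M) :
  is_velocity 0^' alpha t v -> speed F alpha t = F v.
Proof.
move=> av; rewrite /speed; apply: xget_unique; first by exists v.
by move=> _ [w aw <-]; rewrite (is_velocity_unique av aw).
Qed.

(** Where a two-sided velocity exists it equals the right one, or the left one at [b], and these lie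
    in [A]; elsewhere the speed is the default value 0. *)
Lemma speed_ge0 (R : realType) (n : nat) (M : smoothManifold R n)
    (A : set (tangentBundle M)) (F : tangentBundle M -> R) (p q : M) (a b : R)
    (alpha : R -> M) :
  (forall v, A v -> 0 <= F v) -> admissible_curve A p q a b alpha ->
  forall t, t \in `[a, b] -> 0 <= speed F alpha t.
Proof.
move=> F0 aA t; rewrite in_itv/= => /andP[at_ tb]; rewrite /speed.
case: xgetP => // _ -> [v vv <-]; apply: F0.
have [tb'|bt] := ltP t b.
  have [|w Aw wv] := adm_right aA (t := t); first by rewrite at_.
  by rewrite (is_velocity_unique (is_velocity_cvg (@at_right0_dnbhs R) vv) wv).
have [|w Aw wv] := adm_left aA (t := t).
  by rewrite tb (lt_le_trans (adm_lt aA)).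
by rewrite (is_velocity_unique (is_velocity_cvg (@at_left0_dnbhs R) vv) wv).
Qed.

(** The chart velocity is constantly [w], so membership in [A] and the bound [C] on [F] only have to
    be known at the points of the line paired with [w]; integrating [C] bounds the length. *)
Lemma chart_line_admissible (R : realType) (n : nat) (M : smoothManifold R n)
    (A : set (tangentBundle M)) (F : tangentBundle M -> R)
    (phi : chart R n M) (x w : 'rV[R]_n) (t a b C : R) :
  (forall v, A v -> 0 <= F v) -> atlas phi -> a < b -> 0 <= C ->
  (forall s, s \in `[a, b] ->
    (phi @` chart_dom phi) (x + (s - t) *: w) /\
    forall v, tdom phi v -> tchart phi v = (x + (s - t) *: w, w) ->
      A v /\ F v <= C) ->
  let beta := chart_line phi x w t in
  admissible_curve A (beta a) (beta b) a b beta /\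
  (curve_length F a b beta <= (C * (b - a))%:E)%E.
Proof.
move=> F0 aphi ab C0 H beta.
have vel s : s \in `[a, b] ->
    exists v, [/\ is_velocity 0^' beta s v, A v & F v <= C].
  move=> /H[sphi AF]; have [v [vv dv cv]] := chart_line_velocity aphi sphi.
  by have [] := AF v dv cv; exists v.
have adm : admissible_curve A (beta a) (beta b) a b beta.
  split=> //.
  - exists [:: b]; first exact: itv_partition1.
    move=> [|//] _ /=.
    (* The line is its own extension past [a] and [b], on the open set of times at which it stays in
       the image of the chart. *)
    exists [set s : R | (phi @` chart_dom phi) (x + (s - t) *: w)], beta.
    split=> //.
    + apply: (open_comp (f := fun s : R => x + (s - t) *: w)).
        move=> s _.
        exact: differentiable_continuous (differentiable_line _ _ _ _).
      exact: chart_img_open.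
    + by move=> s /= sab; have [] := H s sab.
    + exact: chart_line_smooth.
  - move=> s /andP[as_ sb]; have [|v [vv Av _]] := vel s.
      by rewrite in_itv/= as_ ltW.
    by exists v => //; apply: is_velocity_cvg vv; exact: at_right0_dnbhs.
  - move=> s /andP[as_ sb]; have [|v [vv Av _]] := vel s.
      by rewrite in_itv/= sb ltW.
    by exists v => //; apply: is_velocity_cvg vv; exact: at_left0_dnbhs.
split=> //.
have -> : (C * (b - a))%:E =
    (\int[@lebesgue_measure R]_(s in `[a, b]) cst C%:E s)%E.
  by rewrite integral_cst//= lebesgue_measure_itv/= lte_fin ab EFinM EFinB.
apply: ge0_le_integral_restrict => [s sab|s sab|s].
- by rewrite lee_fin (speed_ge0 F0 adm).
- by rewrite lee_fin.
- rewrite /patch; case: ifPn => // /set_mem sab.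
  have [v [vv _ FC]] := vel _ sab.
  by rewrite (speedE _ vv) lee_fin.
Qed.

(* [G] is [0^'-] at the final time of [alpha] and [0^'+] at its initial time;
   the same segment is then run from [alpha (t + h)] to [q] or from [q] to
   [alpha (t + h)]. *)
Lemma line_to_nearby_point (R : realType) (n : nat) (M : smoothManifold R n)
    (A : set (tangentBundle M)) (F : tangentBundle M -> R)
    (G : set_system R) {FG : Filter G} (alpha : R -> M) (t : R)
    (v : tangentBundle M) :
  open A -> (forall v, A v -> 0 <= F v) ->
  A v -> {for v, continuous F} -> is_velocity G alpha t v ->
  G --> 0^' -> alpha (t + h) @[h --> G] --> alpha t ->
  exists2 C, 0 <= C & \forall h \near G, \forall q \near alpha t,
    exists beta : R -> M, [/\ beta t = q, beta (t + h) = alpha (t + h) &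
      forall a b, a < b -> (forall s, s \in `[a, b] -> `|s - t| <= `|h|) ->
      admissible_curve A (beta a) (beta b) a b beta /\
      (curve_length F a b beta <= (C * (b - a))%:E)%E].
Proof.
move=> oA F0 Av Fv [bv vv] G0 ac; set p := alpha t.
have [phi aphi dphi] := atlas_cover p.
exists (F v + 1); first by rewrite addr_ge0// F0.
set w0 := tcomp v phi.
(* The topology of the tangent bundle turns a neighbourhood of [v] inside [A] on which
   [F <= F v + 1] into an open set [N] of pairs of a position and a velocity. *)
have [N oN [N0 NA]] : exists2 N : set ('rV[R]_n * 'rV[R]_n), open N &
    N (phi p, w0) /\
    forall u, tdom phi u -> N (tchart phi u) -> A u /\ F u <= F v + 1.
  have : nbhs v (A `&` [set u | F u <= F v + 1]).
    apply: filterI; first exact: open_nbhs_nbhs.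
    have : nbhs (F v) [set y | y <= F v + 1].
      have : nbhs (F v) [set y | y < F v + 1].
        by apply: open_nbhs_nbhs; split; [exact: open_lt|rewrite /= ltrDl].
      by apply: filterS => y /ltW.
    exact: Fv.
  rewrite nbhsE => -[U [oU Uv] UA].
  have [N oN NE] := oU phi aphi.
  have dv : tdom phi v by rewrite /tdom/= bv.
  exists N => //; split.
    have : (U `&` tdom phi) v by [].
    by rewrite NE => -[]; rewrite /tchart/= bv.
  move=> u du Nu; apply: UA.
  by have : (tchart phi @^-1` N `&` tdom phi) u by []; rewrite -NE => -[].
(* Balls of a product are products of balls: position and velocity are controlled separately, with
   one radius [e]. *)
have [e /= e0 eW] : exists2 e : R, 0 < e & forall x w, `|phi p - x| < e ->
    `|w0 - w| < e -> N (x, w) /\ (phi @` chart_dom phi) x.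
  have /nbhs_ballP[e1 /= e10 e1N] : nbhs (phi p, w0) N by exact: open_nbhs_nbhs.
  have /nbhs_ballP[e2 /= e20 e2N] : nbhs (phi p) (phi @` chart_dom phi).
    by apply: open_nbhs_nbhs; split; [exact: chart_img_open|exists p].
  exists (Num.min e1 e2); first by rewrite lt_min e10.
  move=> x w; rewrite !lt_min => /andP[x1 x2] /andP[w1 w2]; split.
    by apply: e1N; split; rewrite /= -ball_normE.
  by apply: e2N; rewrite /= -ball_normE.
have phic : phi x @[x --> p] --> phi p by exact: chart_map_continuous.
(* A point of the segment between [x] and [y] is within [|phi p - x| + |y - x|] of [phi p], and
   [|y - x|] is at most the sum of the distances of [x] and [y] to [phi p]: three terms below
   [e / 3]. *)
have e3 : 0 < e / 3 by lra.
have np : nbhs p [set q | chart_dom phi q /\ `|phi p - phi q| < e / 3].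
  apply: filterI; last exact: cvgr_dist_lt phic _ e3.
  by apply: open_nbhs_nbhs; split; [exact: chart_dom_open|].
have pphi : chart_at (alpha t) phi by [].
near=> h.
have h0 : h != 0 by near: h; apply: G0; exact: (nbhs_dnbhs_neq (0 : R)).
have [dh ph] : chart_dom phi (alpha (t + h)) /\
  `|phi p - phi (alpha (t + h))| < e / 3 by near: h; exact: ac np.
have hw : `|w0 - h^-1 *: (phi (alpha (t + h)) - phi p)| < e / 2.
  by near: h; apply: cvgr_dist_lt; [exact: vv|lra].
(* Replacing [phi p] by [phi q] in the difference quotient moves it by [|phi p - phi q| / |h|]. The
   neighbourhood of [q] is therefore chosen after [h], so that this stays below [e / 2]. *)
have nq : nbhs p [set q | `|phi p - phi q| < `|h| * (e / 2)].
  apply: cvgr_dist_lt phic _ _; rewrite mulr_gt0 ?normr_gt0//; lra.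
near=> q.
have [dq pq] : chart_dom phi q /\ `|phi p - phi q| < e / 3 by near: q.
have hq : `|phi p - phi q| < `|h| * (e / 2) by near: q.
set y := phi (alpha (t + h)); set x := phi q.
pose w := h^-1 *: (y - x).
exists (chart_line phi x w t); split.
- by rewrite /chart_line subrr scale0r addr0 chart_mapK.
- rewrite /chart_line addrAC subrr add0r /w scalerA mulfV// scale1r addrC subrK.
  by rewrite chart_mapK.
move=> a b ab abh; apply: chart_line_admissible => //.
  by rewrite addr_ge0// F0.
move=> s /abh sh.
have ww : `|w0 - w| < e.
  rewrite /w -[y - x](subrKA (phi p)) scalerDr opprD addrA.
  rewrite (le_lt_trans (ler_normB _ _))// (splitr e) ltrD//.
  by rewrite normrZ normfV ltr_pdivrMl ?normr_gt0.
have yx : `|y - x| < e / 3 + e / 3.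
  have -> : y - x = (phi p - x) - (phi p - y).
    by rewrite opprB [RHS]addrC subrKA.
  by rewrite (le_lt_trans (ler_normB _ _))// ltrD.
have sw : `|(s - t) *: w| <= `|y - x|.
  rewrite !normrZ normfV mulrA -[leRHS]mul1r ler_wpM2r//.
  by rewrite ler_pdivrMr ?mul1r// normr_gt0.
have xw : `|phi p - (x + (s - t) *: w)| < e.
  rewrite opprD addrA (le_lt_trans (ler_normB _ _))//.
  by rewrite (le_lt_trans (lerD (lexx _) sw))//; lra.
have [Nxw dxw] := eW _ _ xw ww.
by split=> // u du uE; apply: NA => //; rewrite uE.
Unshelve. all: by end_near. Qed.

(** * Restriction and concatenation of curves *)

Lemma smooth_on_segment_sub (R : realType) (n : nat) (M : smoothManifold R n)
    (s t s' t' : R) (alpha beta : R -> M) :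
  s <= s' -> t' <= t -> (forall u, u \in `[s', t'] -> alpha u = beta u) ->
  smooth_on_segment s t alpha -> smooth_on_segment s' t' beta.
Proof.
move=> ss tt ab [J [g [oJ stJ gJ ga]]].
have sub u : u \in `[s', t'] -> u \in `[s, t].
  by rewrite !in_itv/= => /andP[/(le_trans ss)-> /le_trans->].
exists J, g; split=> // u ust; first exact/stJ/sub.
by rewrite ga ?ab// sub.
Qed.

Lemma piecewise_smooth_refl (R : realType) (n : nat) (M : smoothManifold R n)
    (a : R) (alpha : R -> M) : piecewise_smooth a a alpha.
Proof. by exists [::] => //; split=> /=. Qed.

Lemma piecewise_smooth_cons (R : realType) (n : nat) (M : smoothManifold R n)
    (a x b : R) (alpha : R -> M) :
  a < x -> smooth_on_segment a x alpha -> piecewise_smooth x b alpha ->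
  piecewise_smooth a b alpha.
Proof.
move=> ax sax [s [ps ls] ss]; exists (x :: s).
  by split=> //=; rewrite ax.
by move=> [//|i]; exact: ss.
Qed.

(** Makes [piecewise_smooth] behave like an inductive predicate, built from the empty partition by
    adding a first smooth piece, so that the following proofs do not handle partitions. *)
Lemma piecewise_smooth_ind (R : realType) (n : nat) (M : smoothManifold R n)
    (b : R) (alpha : R -> M) (P : R -> Prop) :
  P b ->
  (forall a x, a < x -> x <= b -> smooth_on_segment a x alpha ->
    piecewise_smooth x b alpha -> P x -> P a) ->
  forall a, piecewise_smooth a b alpha -> P a.
Proof.
move=> Pb IHP a [s]; elim: s a => [a /itv_partition_nil -> //|x s IH a pxs sxs].
have px := itv_partition_cons pxs.
have sx i : (i < size s)%N ->
    smooth_on_segment (nth b (x :: s) i) (nth b (x :: s) i.+1) alpha.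
  by move=> si; exact: (sxs i.+1).
apply: (IHP a x); [|exact: itv_partition_le px|exact: (sxs 0%N)| |exact: IH].
  by case: pxs => /andP[].
by exists s.
Qed.

Lemma piecewise_smooth_eq (R : realType) (n : nat) (M : smoothManifold R n)
    (a b : R) (alpha beta : R -> M) :
  (forall u, u \in `[a, b] -> alpha u = beta u) ->
  piecewise_smooth a b alpha -> piecewise_smooth a b beta.
Proof.
move=> + H; elim/(@piecewise_smooth_ind R n M b alpha): a / H.
  by move=> _; exact: piecewise_smooth_refl.
move=> a x ax xb sax _ IH ab; apply: (piecewise_smooth_cons ax).
  apply: smooth_on_segment_sub sax => // u; rewrite in_itv/= => /andP[au ux].
  by rewrite ab// in_itv/= au (le_trans ux).
apply: IH => u; rewrite in_itv/= => /andP[xu ub].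
by rewrite ab// in_itv/= ub (le_trans (ltW ax)).
Qed.

Lemma piecewise_smooth_cat (R : realType) (n : nat) (M : smoothManifold R n)
    (a c b : R) (alpha : R -> M) :
  piecewise_smooth a c alpha -> piecewise_smooth c b alpha ->
  piecewise_smooth a b alpha.
Proof.
move=> H cb; elim/(@piecewise_smooth_ind R n M c alpha): a / H => //.
move=> a x ax _ sax _; exact: piecewise_smooth_cons.
Qed.

Lemma piecewise_smoothR (R : realType) (n : nat) (M : smoothManifold R n)
    (a c b : R) (alpha : R -> M) :
  a <= c <= b -> piecewise_smooth a b alpha -> piecewise_smooth c b alpha.
Proof.
move=> + H; elim/(@piecewise_smooth_ind R n M b alpha): a / H.
  by move=> /le_anti ->; exact: piecewise_smooth_refl.
move=> a x ax xb sax pxb IH /andP[ac cb].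
have [cx|xc] := ltP c x; last by apply: IH; rewrite xc.
by apply: (piecewise_smooth_cons cx) => //; apply: smooth_on_segment_sub sax.
Qed.

Lemma piecewise_smoothL (R : realType) (n : nat) (M : smoothManifold R n)
    (a c b : R) (alpha : R -> M) :
  a <= c <= b -> piecewise_smooth a b alpha -> piecewise_smooth a c alpha.
Proof.
move=> + H; elim/(@piecewise_smooth_ind R n M b alpha): a / H.
  by move=> /le_anti ->; exact: piecewise_smooth_refl.
move=> a x ax xb sax pxb IH /andP[].
rewrite le_eqVlt => /predU1P[<- _|ac cb]; first exact: piecewise_smooth_refl.
have [cx|xc] := leP c x.
  apply: (piecewise_smooth_cons ac); last exact: piecewise_smooth_refl.
  exact: smooth_on_segment_sub sax.
by apply: (piecewise_smooth_cons ax) => //; apply: IH; rewrite (ltW xc).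
Qed.

Lemma piecewise_smooth_first (R : realType) (n : nat) (M : smoothManifold R n)
    (a b : R) (alpha : R -> M) : a < b -> piecewise_smooth a b alpha ->
  exists2 x, a < x & smooth_on_segment a x alpha.
Proof.
move=> + H; elim/(@piecewise_smooth_ind R n M b alpha): a / H.
  by rewrite ltxx.
by move=> a x ax _ sax _ _ _; exists x.
Qed.

Lemma piecewise_smooth_last (R : realType) (n : nat) (M : smoothManifold R n)
    (a b : R) (alpha : R -> M) : a < b -> piecewise_smooth a b alpha ->
  exists2 x, x < b & smooth_on_segment x b alpha.
Proof.
move=> + H; elim/(@piecewise_smooth_ind R n M b alpha): a / H.
  by rewrite ltxx.
move=> a x ax; rewrite le_eqVlt => /predU1P[<- sax _ _ _|xb _ _ IH _].
  by exists a.
exact: IH.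
Qed.

(** The limit is read on the smooth extension [g] of the first piece, which is continuous at [a] and
    agrees with [alpha] just to the right of [a]. *)
Lemma piecewise_smooth_cvg_right (R : realType) (n : nat)
    (M : smoothManifold R n) (a b : R) (alpha : R -> M) :
  a < b -> piecewise_smooth a b alpha ->
  alpha (a + h) @[h --> 0^'+] --> alpha a.
Proof.
move=> ab /(piecewise_smooth_first ab)[x ax [J [g [oJ axJ [gJ _] ga]]]].
have aax : a \in `[a, x] by rewrite in_itv/= lexx ltW.
rewrite -(ga _ aax) => U /(gJ _ (axJ _ aax)).
move=> /(near_addr_dnbhs (@at_right0_dnbhs R)) gU.
have : \forall h \near (0 : R)^'+, U (alpha (a + h)); last exact.
near=> h; rewrite -ga; first exact: (near gU h).
have h0 : 0 < h by [].
have hx : h < x - a by near: h; apply: nbhs_right_lt; rewrite subr_gt0.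
rewrite in_itv/=; apply/andP; split; lra.
Unshelve. all: by end_near. Qed.

Lemma piecewise_smooth_cvg_left (R : realType) (n : nat)
    (M : smoothManifold R n) (a b : R) (alpha : R -> M) :
  a < b -> piecewise_smooth a b alpha ->
  alpha (b + h) @[h --> 0^'-] --> alpha b.
Proof.
move=> ab /(piecewise_smooth_last ab)[x xb [J [g [oJ xbJ [gJ _] ga]]]].
have bxb : b \in `[x, b] by rewrite in_itv/= lexx ltW.
rewrite -(ga _ bxb) => U /(gJ _ (xbJ _ bxb)).
move=> /(near_addr_dnbhs (@at_left0_dnbhs R)) gU.
have : \forall h \near (0 : R)^'-, U (alpha (b + h)); last exact.
near=> h; rewrite -ga; first exact: (near gU h).
have h0 : h < 0 by [].
have hx : x - b < h by near: h; apply: nbhs_left_gt; rewrite subr_lt0.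
rewrite in_itv/=; apply/andP; split; lra.
Unshelve. all: by end_near. Qed.

Lemma admissible_curveL (R : realType) (n : nat) (M : smoothManifold R n)
    (A : set (tangentBundle M)) (p q : M) (a c b : R) (alpha : R -> M) :
  a < c <= b -> admissible_curve A p q a b alpha ->
  admissible_curve A p (alpha c) a c alpha.
Proof.
move=> /andP[ac cb] [ab sab ap bq rv lv]; split=> //.
- by apply: piecewise_smoothL sab; rewrite ltW.
- by move=> t /andP[at_ tc]; apply: rv; rewrite at_ (lt_le_trans tc).
- by move=> t /andP[at_ tc]; apply: lv; rewrite at_ (le_trans tc).
Qed.

Lemma admissible_curveR (R : realType) (n : nat) (M : smoothManifold R n)
    (A : set (tangentBundle M)) (p q : M) (a c b : R) (alpha : R -> M) :
  a <= c < b -> admissible_curve A p q a b alpha ->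
  admissible_curve A (alpha c) q c b alpha.
Proof.
move=> /andP[ac cb] [ab sab ap bq rv lv]; split=> //.
- by apply: piecewise_smoothR sab; rewrite ac ltW.
- by move=> t /andP[ct tb]; apply: rv; rewrite tb (le_trans ac).
- by move=> t /andP[ct tb]; apply: lv; rewrite tb (le_lt_trans ac).
Qed.

Lemma curve_length_sub (R : realType) (n : nat) (M : smoothManifold R n)
    (A : set (tangentBundle M)) (F : tangentBundle M -> R) (p q : M)
    (a b a' b' : R) (alpha : R -> M) :
  (forall v, A v -> 0 <= F v) -> admissible_curve A p q a b alpha ->
  a <= a' -> b' <= b ->
  (curve_length F a' b' alpha <= curve_length F a b alpha)%E.
Proof.
move=> F0 aA aa bb; have s0 := speed_ge0 F0 aA.
have sub t : t \in `[a', b'] -> t \in `[a, b].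
  by rewrite !in_itv/= => /andP[/(le_trans aa)-> /le_trans->].
apply: ge0_le_integral_restrict => [t /= /sub|t /=|t].
- by rewrite lee_fin => /s0.
- by rewrite lee_fin => /s0.
- rewrite /patch; case: ifPn => [|_].
    rewrite inE/= => /sub tab; rewrite ifT// inE/=; exact: tab.
  by case: ifPn => //; rewrite inE/= lee_fin => /s0.
Qed.

(** At the junction [c] the left velocity comes from [alpha] and the right one from [beta]; they may
    differ, which piecewise smoothness allows. At any other time the new curve agrees locally with
    one of the two and has its speed. *)
Lemma admissible_curve_cat (R : realType) (n : nat) (M : smoothManifold R n)
    (A : set (tangentBundle M)) (F : tangentBundle M -> R) (p x q : M)
    (a c b : R) (alpha beta : R -> M) :
  (forall v, A v -> 0 <= F v) -> admissible_curve A p x a c alpha ->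
  admissible_curve A x q c b beta ->
  exists2 gamma, admissible_curve A p q a b gamma &
    (curve_length F a b gamma <=
      curve_length F a c alpha + curve_length F c b beta)%E.
Proof.
move=> F0 Aalpha Abeta.
pose gamma t := if t <= c then alpha t else beta t.
have ac := adm_lt Aalpha; have cb := adm_lt Abeta.
have gammaL t : t <= c -> gamma t = alpha t by rewrite /gamma => ->.
have gammaR t : c <= t -> gamma t = beta t.
  rewrite /gamma le_eqVlt => /predU1P[<-|ct]; last by rewrite leNgt ct.
  by rewrite lexx (adm_end Aalpha) (adm_start Abeta).
have gammaLn t : t < c -> \forall s \near t, alpha s = gamma s.
  move=> tc; near=> s; rewrite gammaL// ltW//; near: s.
  by apply: open_nbhs_nbhs; split=> //; exact: open_lt.
have gammaRn t : c < t -> \forall s \near t, beta s = gamma s.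
  move=> ct; near=> s; rewrite gammaR// ltW//; near: s.
  by apply: open_nbhs_nbhs; split=> //; exact: open_gt.
have adm : admissible_curve A p q a b gamma.
  split.
  - exact: lt_trans cb.
  - apply: (@piecewise_smooth_cat _ _ _ _ c).
      apply: piecewise_smooth_eq (adm_smooth Aalpha) => u.
      by rewrite in_itv/= => /andP[_ uc]; rewrite gammaL.
    apply: piecewise_smooth_eq (adm_smooth Abeta) => u.
    by rewrite in_itv/= => /andP[cu _]; rewrite gammaR.
  - by rewrite gammaL ?(adm_start Aalpha)// ltW.
  - by rewrite gammaR ?(adm_end Abeta)// ltW.
  - move=> t /andP[at_ tb]; have [tc|ct] := ltP t c.
      have [|v Av vv] := adm_right Aalpha (t := t); first by rewrite at_.
      exists v => //; apply: is_velocity_near vv; first by rewrite gammaL// ltW.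
      by apply: near_addr_dnbhs (gammaLn _ tc); exact: at_right0_dnbhs.
    have [|v Av vv] := adm_right Abeta (t := t); first by rewrite ct.
    exists v => //; apply: is_velocity_near vv; first by rewrite gammaR.
    near=> h; rewrite gammaR// ler_wpDr// ltW.
  - move=> t /andP[at_ tb]; have [tc|ct] := leP t c.
      have [|v Av vv] := adm_left Aalpha (t := t); first by rewrite at_.
      exists v => //; apply: is_velocity_near vv; first by rewrite gammaL.
      near=> h; rewrite gammaL// ler_wnDr// ltW.
    have [|v Av vv] := adm_left Abeta (t := t); first by rewrite ct.
    exists v => //; apply: is_velocity_near vv; first by rewrite gammaR// ltW.
    by apply: near_addr_dnbhs (gammaRn _ ct); exact: at_left0_dnbhs.
exists gamma => //; apply: ge0_integral_itv_cat_le => t tI.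
- by rewrite lee_fin (speed_ge0 F0 adm).
- by rewrite lee_fin (speed_ge0 F0 Aalpha).
- by rewrite lee_fin (speed_ge0 F0 Abeta).
- move: tI; rewrite in_itv/= => /andP[_ tc].
  by rewrite (speed_near _ (gammaLn _ tc)).
- move: tI; rewrite in_itv/= => /andP[ct _].
  by rewrite (speed_near _ (gammaRn _ ct)).
Unshelve. all: by end_near. Qed.

(** * The separation and the openness of its balls *)

Lemma finsler_separation_lt (R : realType) (n : nat) (M : smoothManifold R n)
    (A : set (tangentBundle M)) (F : tangentBundle M -> R) (p q : M) (r : R) :
  (forall v, A v -> 0 <= F v) -> (finsler_separation A F p q < r%:E)%E ->
  exists a b alpha (l : R), [/\ admissible_curve A p q a b alpha,
    curve_length F a b alpha = l%:E & l < r].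
Proof.
move=> F0 /ereal_inf_lt[_ [a [b [alpha [aA ->]]]] lr].
(* Being nonnegative and below [r], the length is a real number [l], and the slack [r - l] is a
   positive real. *)
have l0 : (0 <= curve_length F a b alpha)%E.
  apply: integral_ge0 => t /= tab; rewrite lee_fin; exact: (speed_ge0 F0 aA).
exists a, b, alpha, (fine (curve_length F a b alpha)).
have lE : (fine (curve_length F a b alpha))%:E = curve_length F a b alpha.
  by rewrite fineK// ge0_fin_numE// (lt_trans lr)// ltry.
by split=> //; rewrite -lte_fin lE.
Qed.

Lemma finsler_separation_le (R : realType) (n : nat) (M : smoothManifold R n)
    (A : set (tangentBundle M)) (F : tangentBundle M -> R) (p q : M) (a b : R)
    (alpha : R -> M) : admissible_curve A p q a b alpha ->
  (finsler_separation A F p q <= curve_length F a b alpha)%E.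
Proof. by move=> aA; apply: ereal_inf_lbound; exists a, b, alpha. Qed.

Theorem proposition3p9 (R : realType) (n : nat) (M : smoothManifold R n)
    (M_connected : connected [set: M])
    (A : set (tangentBundle M)) (F : tangentBundle M -> R)
    (F_finsler : conicPseudoFinsler A F)
    (p : M) (r : R) (r_gt0 : 0 < r) :
  open (forward_ball A F p r) /\ open (backward_ball A F p r).
Proof.
have oA := cpf_open F_finsler; have F0 := cpf_ge0 F_finsler.
split; rewrite openE => q /= /(finsler_separation_lt F0)
    [a [b [alpha [l [aA lE lr]]]]]; have ab := adm_lt aA.
(* Forward ball: the end of [alpha] is replaced, with a negative increment [h] from the final time
   [b]. *)
- have [|v Av vv] := adm_left aA (t := b); first by rewrite ab lexx.
  have ac := piecewise_smooth_cvg_left ab (adm_smooth aA).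
  have [C C0 lines] := line_to_nearby_point oA F0 Av
    (cpf_continuous F_finsler Av) vv (@at_left0_dnbhs R) ac.
  (* The second bound leaves a nondegenerate initial part of [alpha]; the third makes the added
     length at most [C * - h < r - l], with [C + 1] as denominator because [C] may be 0. *)
  have small : \forall h \near (0 : R)^'-,
      [/\ h < 0, a - b < h & - ((r - l) / (C + 1)) < h].
    near=> h; split=> //; near: h; apply: nbhs_left_gt; first by lra.
    by rewrite oppr_lt0 divr_gt0 ?subr_gt0//; lra.
  have [h [[h0 ha hr] nq]] := filter_ex (filterI small lines).
  have Ch : l + C * - h < r by move: hr; rewrite ltrNl ltr_pdivlMr; nra.
  move: nq; rewrite (adm_end aA); apply: filterS => q' [beta [bq' bh betaP]].
  have [||bA bl] := betaP (b + h) b; first lra.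
    move=> s; rewrite in_itv/= => /andP[hs sb].
    by rewrite ler0_norm ?ltr0_norm//; lra.
  rewrite bq' bh in bA.
  have acb : a < b + h <= b by apply/andP; split; lra.
  have [gamma gA gl] := admissible_curve_cat F0 (admissible_curveL acb aA) bA.
  apply: le_lt_trans (finsler_separation_le F gA) _.
  apply: (le_lt_trans gl); rewrite -lte_fin in Ch; apply: le_lt_trans Ch.
  rewrite EFinD -lE; apply: leeD.
    by apply: (curve_length_sub F0 aA) => //; lra.
  by apply: (le_trans bl); rewrite lee_fin opprD addNKr.
(* Backward ball: the segment from [q'] now comes first, on [[a, a + h]] with [h > 0], followed by
   the rest of [alpha]. *)
- have [|v Av vv] := adm_right aA (t := a); first by rewrite ab lexx.
  have ac := piecewise_smooth_cvg_right ab (adm_smooth aA).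
  have [C C0 lines] := line_to_nearby_point oA F0 Av
    (cpf_continuous F_finsler Av) vv (@at_right0_dnbhs R) ac.
  have small : \forall h \near (0 : R)^'+,
      [/\ 0 < h, h < b - a & h < (r - l) / (C + 1)].
    near=> h; split=> //; near: h; apply: nbhs_right_lt; first by lra.
    by rewrite divr_gt0 ?subr_gt0//; lra.
  have [h [[h0 hb hr] nq]] := filter_ex (filterI small lines).
  have Ch : C * h + l < r by move: hr; rewrite ltr_pdivlMr; nra.
  move: nq; rewrite (adm_start aA); apply: filterS => q' [beta [bq' bh betaP]].
  have [||bA bl] := betaP a (a + h); first lra.
    move=> s; rewrite in_itv/= => /andP[as_ sh].
    by rewrite ger0_norm ?gtr0_norm//; lra.
  rewrite bq' bh in bA.
  have acb : a <= a + h < b by apply/andP; split; lra.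
  have [gamma gA gl] := admissible_curve_cat F0 bA (admissible_curveR acb aA).
  apply: le_lt_trans (finsler_separation_le F gA) _.
  apply: (le_lt_trans gl); rewrite -lte_fin in Ch; apply: le_lt_trans Ch.
  rewrite EFinD -lE; apply: leeD.
    by apply: (le_trans bl); rewrite lee_fin addrAC subrr add0r.
  by apply: (curve_length_sub F0 aA) => //; lra.
Unshelve. all: by end_near. Qed.
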